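(* If $\Omega$ is a John domain, then there is a positive integer $N$, depending only on the doubling constant $C_\mu$, the John constant $C_\Omega$ and the quasiconvexity constant $L$ of $X$, such that for every $x\in\partial\Omega$ there is at least one, and at most $N$, prime ends with impression $\{x\}$. If $\Omega$ is a uniform domain, then for every $x\in\partial\Omega$ there is exactly one prime end with impression $\{x\}$. Moreover (for uniform $\Omega$), there is a homeomorphism $\Upsilon:\overline\Omega^P\to\overline\Omega$ such that $\Upsilon|_\Omega$ is the identity map.
   Context: Setting: $(X,d,\mu)$ is a metric measure space with more than one point, $\mu$ is a Borel measure with $0<\mu(B)<\infty$ for all balls $B$, and $1\le p<\infty$ is fixed. $X$ is complete, $\mu$ is doubling with doubling constant $C_\mu$ ($\mu(B(x,2r))\le C_\mu\mu(B(x,r))$ for all balls), and $X$ supports a $p$-Poincaré inequality: there are $C_{PI}>0$, $\lambda\ge1$ such that for all balls $B$ and all $u\in N^{1,p}(X)$, $\frac{1}{\mu(B)}\int_B|u-u_B|\,d\mu\le C_{PI}\operatorname{diam}(B)\bigl(\frac{1}{\mu(\lambda B)}\int_{\lambda B}g_u^p\,d\mu\bigr)^{1/p}$, where $u_B=\frac{1}{\mu(B)}\int_B u\,d\mu$. Here a nonnegative Borel function $g$ is an upper gradient of $u:X\to[-\infty,\infty]$ if for every nonconstant rectifiable curve $\gamma:[0,l_\gamma]\to X$ parameterized by arc length, $|u(\gamma(0))-u(\gamma(l_\gamma))|\le\int_\gamma g\,ds$ when both values are finite, and $\int_\gamma g\,ds=\infty$ otherwise; $N^{1,p}(X)$ is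 the space of measurable $u$ with $\int_X|u|^p\,d\mu+\inf_g\int_X g^p\,d\mu<\infty$ (infimum over upper gradients $g$ of $u$), and $g_u$ is the minimal $p$-weak upper gradient of $u$ (the a.e.-smallest $L^p$ function satisfying the upper gradient inequality for all curves except a family $\Gamma$ for which some nonnegative Borel $\rho\in L^p(X)$ has $\int_\gamma\rho\,ds=\infty$ for all $\gamma\in\Gamma$). These assumptions imply (known) that $X$ is $L$-quasiconvex for some $L$: every $x,y\in X$ can be connected by a rectifiable curve of length at most $L\,d(x,y)$; $L$ is the quasiconvexity constant. $\Omega\subsetneq X$ is a bounded domain (bounded nonempty connected open set); closures and boundaries of subsets of $\Omega$ are taken in $X$, and $\overline\Omega$ has the metric topology of $X$. John and uniform domains: write $\delta_\Omega(x)=\operatorname{dist}(x,X\setminus\Omega)$. $\Omega$ is a John domain with John constant $C_\Omega\ge1$ and John center $x_0\in\Omega$ if every $x\in\Omega$ can be joined to $x_0$ by a rectifiable curve $\gamma:[0,l_\gamma]\to\Omega$ parameterized by arc length with $\gamma(0)=x$, $\gamma(l_\gamma)=x_0$ and $t\le C_\Omega\delta_\Omega(\gamma(t))$ for $0\le t\le l_\gamma$. $\Omega$ is a uniform domain if there is $C_\Omega\ge1$ such that all $x,y\in\Omega$ can be joined by a rectifiable curve $\gamma:[0,l_\gamma]\to\Omega$ parameterized by arc length with $l_\gamma\le C_\Omega d(x,y)$ and $\min\{t,l_\gamma-t\}\le C_\Omega\delta_\Omega(\gamma(t))$ for $0\le t\le l_\gamma$. Ends: A bounded connected set $E\subsetneq\Omega$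 is acceptable if $\overline E\cap\partial\Omega\ne\varnothing$. A sequence $\{E_k\}_{k=1}^\infty$ of acceptable sets is a chain if (i) $E_{k+1}\subset E_k$ for all $k$; (ii) $\operatorname{dist}(\Omega\cap\partial E_{k+1},\Omega\cap\partial E_k)>0$ for all $k$; (iii) the impression $\bigcap_{k=1}^\infty\overline{E}_k$ is contained in $\partial\Omega$. A chain $\{E_k\}$ divides a chain $\{F_k\}$ if for each $k$ there is $l$ with $E_l\subset F_k$. Two chains are equivalent if they divide each other; an end $[E_k]$ is an equivalence class of chains, and its impression $I[E_k]$ is the impression of any representative chain. Division is well defined between ends. A prime end is an end that is not divisible by any other end. $\partial_E\Omega$ is the set of all ends, $\partial_P\Omega$ the set of all prime ends, and $\overline\Omega^P=\Omega\cup\partial_P\Omega$ is the prime end closure. Topology on $\Omega\cup\partial_E\Omega$: a sequence of points $\{x_n\}$ in $\Omega$ converges to the end $[E_k]$ if for all $k$ there is $n_k$ with $x_n\in E_k$ whenever $n\ge n_k$. A sequence of ends $\{[E_k^n]\}_{n=1}^\infty$ converges to the end $[E_k^\infty]$ if for every $k$ there is $n_k$ such that for each $n\ge n_k$ there is $l_{n,k}$ with $E^n_{l_{n,k}}\subset E_k^\infty$. Points of $\Omega$ converge to points of $\Omega$ as in the metric topology, and no sequence of ends converges to a point of $\Omega$. A set $C\subset\Omega\cup\partial_E\Omega$ is closed if every $y\in\Omega\cup\partial_E\Omega$ which is a limit of a sequence in $C$ belongs to $C$. $\overline\Omega^P$ carries the induced topology. *)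

(* Defs.v *)
From HB Require Import structures.
From mathcomp Require Import all_boot all_order all_algebra.
From mathcomp Require Import all_classical all_reals all_analysis.
From mathcomp Require Import measurable_realfun.

Set Implicit Arguments.
Unset Strict Implicit.
Unset Printing Implicit Defensive.

Import Order.TTheory GRing.Theory Num.Theory.
Import numFieldNormedType.Exports.

Local Open Scope classical_set_scope.
Local Open Scope ring_scope.

(* [Complete] includes a distinguished point; this loses no generality here,
   since the spaces considered have more than one point. *)
#[short(type="completeMetricType")]
HB.structure Definition CompleteMetric (K : numDomainType) :=
  { M of Metric K M & Complete M }.

Section Metric.
Context {R : realType} {X : metricType R}.
Implicit Types (A B : set X) (x y : X) (c : R -> X) (l C L : R).

Definition diam A : \bar R :=
  ereal_sup [set (mdist x y)%:E | x in A & y in A].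

Definition mbounded A : Prop := (diam A < +oo)%E.

(* equal to [+oo] as soon as one of the two sets is empty *)
Definition set_dist A B : \bar R :=
  ereal_inf [set (mdist x y)%:E | x in A & y in B].

Definition boundary A : set X := closure A `\` interior A.

Definition domain A : Prop :=
  [/\ open A, connected A, A !=set0 & mbounded A].

Definition curve_variation (a b : R) c (s : seq R) : R :=
  let F := c \o nth b (a :: s) in
  \sum_(0 <= n < size s) mdist (F n) (F n.+1).

Definition curve_length (a b : R) c : \bar R :=
  ereal_sup [set (curve_variation a b c s)%:E | s in itv_partition a b].

(* [c], restricted to [0, l], is a rectifiable curve parameterized by arc
   length; continuity follows, and the curve is nonconstant iff [0 < l]. *)
Definition arclength_curve c l : Prop :=
  0 <= l /\ forall s t, 0 <= s -> s <= t -> t <= l ->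
    curve_length s t c = (t - s)%:E.

Definition quasiconvex L : Prop :=
  forall x y, exists (a b : R) c,
    [/\ a <= b, {within `[a, b], continuous c}, c a = x, c b = y
      & (curve_length a b c <= (L * mdist x y)%:E)%E].

Definition dist_compl (Om : set X) x : \bar R := set_dist [set x] (~` Om).

Definition john (Om : set X) C (x0 : X) : Prop :=
  [/\ 1 <= C, Om x0 & forall x, Om x -> exists c l,
    [/\ arclength_curve c l, forall t, 0 <= t <= l -> Om (c t),
        c 0 = x, c l = x0
      & forall t, 0 <= t <= l -> (t%:E <= C%:E * dist_compl Om (c t))%E]].

Definition uniform_domain (Om : set X) : Prop :=
  exists2 C, 1 <= C & forall x y, Om x -> Om y -> exists c l,
    [/\ arclength_curve c l, forall t, 0 <= t <= l -> Om (c t),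
        c 0 = x /\ c l = y, l <= C * mdist x y
      & forall t, 0 <= t <= l ->
          ((Num.min t (l - t))%:E <= C%:E * dist_compl Om (c t))%E].

End Metric.
Arguments quasiconvex {R} X L.

Section Ends.
Context {R : realType} {X : metricType R}.
Implicit Types (Om : set X) (E F : nat -> set X) (e f : set (nat -> set X)).

Definition acceptable Om (A : set X) : Prop :=
  [/\ mbounded A, connected A, A `<` Om & closure A `&` boundary Om !=set0].

Definition chain Om E : Prop :=
  [/\ forall k, acceptable Om (E k),
      forall k, E k.+1 `<=` E k,
      forall k, (0 < set_dist (Om `&` boundary (E k.+1))
                              (Om `&` boundary (E k)))%E
    & \bigcap_k closure (E k) `<=` boundary Om].

Definition divides E F : Prop := forall k, exists l, E l `<=` F k.

Definition chain_equiv E F : Prop := divides E F /\ divides F E.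

Definition ends Om : set (set (nat -> set X)) :=
  [set e | exists2 E, chain Om E &
             e = [set F | chain Om F /\ chain_equiv E F]].

(* All representatives of an end have the same impression, see
   [impressionE]. *)
Definition impression e : set X := \bigcup_(E in e) \bigcap_k closure (E k).

Definition end_divides e f : Prop :=
  exists E F, [/\ e E, f F & divides E F].

Definition prime_ends Om : set (set (nat -> set X)) :=
  [set e | ends Om e /\ forall f, ends Om f -> end_divides f e -> f = e].

Lemma impressionE Om e E : ends Om e -> e E ->
  impression e = \bigcap_k closure (E k).
Proof.
move=> [E0 _ ->] [cE [E0E EE0]]; apply/seteqP; split=> [x|x xE]; last by exists E.
move=> [F [_ [E0F FE0]] xF] k _; have [l E0lEk] := E0E k.
have [m Fm] := FE0 l; exact: closureS (subset_trans Fm E0lEk) _ (xF m I).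
Qed.

(* The space of points and ends; sets coerce to subtypes. *)
Variant end_space (Om : set X) : Type :=
  | Pt of Om
  | End of ends Om.

HB.instance Definition _ Om := gen_eqMixin (end_space Om).
HB.instance Definition _ Om := gen_choiceMixin (end_space Om).

Definition points_cvg_end (u : nat -> X) e : Prop :=
  forall E, e E -> forall k, \forall n \near \oo, E k (u n).

Definition ends_cvg_end (f : nat -> set (nat -> set X)) e : Prop :=
  forall E, e E -> forall k, \forall n \near \oo,
    forall F, f n F -> exists l, F l `<=` E k.

(* Only sequences consisting entirely of points or entirely of ends are
   considered. *)
Definition end_space_cvg Om (z : nat -> end_space Om) (y : end_space Om) :=
  match y with
  | Pt x => exists2 u : nat -> Om, z = @Pt Om \o u &
      (fun n => set_val (u n)) @ \oo --> set_val x
  | End e =>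
      (exists2 u : nat -> Om, z = @Pt Om \o u &
        points_cvg_end (fun n => set_val (u n)) (set_val e)) \/
      (exists2 f : nat -> ends Om, z = @End Om \o f &
        ends_cvg_end (fun n => set_val (f n)) (set_val e))
  end.

Definition end_space_closed Om (C : set (end_space Om)) : Prop :=
  forall (z : nat -> end_space Om) y,
    (forall n, C (z n)) -> end_space_cvg z y -> C y.

Definition end_space_open Om (U : set (end_space Om)) : Prop :=
  end_space_closed (~` U).

Lemma end_space_cvg_subseq Om (z : nat -> end_space Om) y (phi : nat -> nat) :
  (forall n, (n <= phi n)%N) -> end_space_cvg z y ->
  end_space_cvg (z \o phi) y.
Proof.
move=> nphi; have phioo : phi @ \oo --> \oo.
  by move=> A [N _ NA]; exists N => // n /= Nn; apply: NA => /=; exact: leq_trans (nphi n).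
case: y => [x [u -> ux]|e [[u -> ue]|[f -> fe]]] /=.
- by exists (u \o phi) => //; exact: (cvg_comp phi (set_val \o u) phioo ux).
- left; exists (u \o phi) => // E eE k; exact: phioo (ue E eE k).
- right; exists (f \o phi) => // E eE k; exact: phioo (fe E eE k).
Qed.

Lemma end_space_openT Om : end_space_open [set: end_space Om].
Proof. by move=> z y /(_ 0%N) /(_ I). Qed.

Lemma end_space_openI Om : setI_closed (@end_space_open Om).
Proof.
move=> A B oA oB z y; rewrite setCI => zAB zy.
have [[n0 An0]|] := pselect (exists n0, forall n, (n0 <= n)%N -> (~` A) (z n)).
  left; apply: (oA (z \o addn n0)) => [n|]; first exact/An0/leq_addr.
  by apply: end_space_cvg_subseq zy => n; exact: leq_addl.
move=> /forallNP nA; right.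
have /choice[phi phiP] n : exists m, (n <= m)%N /\ (~` B) (z m).
  have /existsNP[m /not_implyP[nm nAm]] := nA n.
  by exists m; split=> //; case: (zAB m).
by apply: (oB (z \o phi)) => [n|]; [case: (phiP n)|
  apply: end_space_cvg_subseq zy => n; case: (phiP n)].
Qed.

Lemma end_space_open_bigU Om (I : Type) (f : I -> set (end_space Om)) :
  (forall i, end_space_open (f i)) -> end_space_open (\bigcup_i f i).
Proof.
move=> of_ z y zf zy [i _ fiy].
by apply: (of_ i z y) => // n fizn; apply: (zf n); exists i.
Qed.

HB.instance Definition _ Om := isOpenTopological.Build (end_space Om)
  (@end_space_openT Om) (@end_space_openI Om) (@end_space_open_bigU Om).

Lemma closed_end_spaceE Om : closed = @end_space_closed Om.
Proof.
apply/funext => C; apply/propext; rewrite -openC -[X in _ <-> end_space_closed X]setCK.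
by [].
Qed.

Definition prime_end_closure Om : set (end_space Om) :=
  [set z | match z with
           | Pt _ => True
           | End e => prime_ends Om (set_val e)
           end].

End Ends.
Arguments prime_end_closure {R X} Om _.

Definition homeomorphism {S T : topologicalType} (h : S -> T) : Prop :=
  exists g : T -> S,
    [/\ cancel h g, cancel g h, continuous h & continuous g].

Notation borel X := (g_sigma_algebraType (@open X)).

Section NewtonSobolev.
Context {R : realType} {X : completeMetricType R}.
Context (mu : {measure set (borel X) -> \bar R}) (p : R).
Local Open Scope ereal_scope.
Implicit Types (c : R -> X) (l : R) (g u : borel X -> \bar R).

Definition ball_measure_pos_fin : Prop :=
  forall (x : X) (r : R), (0 < r)%R -> 0 < mu (ball x r) < +oo.

Definition doubling (Cmu : R) : Prop :=
  forall (x : X) (r : R), (0 < r)%R ->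
    mu (ball x (2 * r)%R) <= Cmu%:E * mu (ball x r).

Definition nonneg_borel g : Prop :=
  measurable_fun setT g /\ forall x, 0 <= g x.

Definition line_integral c l g : \bar R :=
  \int[lebesgue_measure]_(t in `[0%R, l]) g (c t).

Definition upper_gradient_on u g c l : Prop :=
  if (u (c 0%R) \is a fin_num) && (u (c l) \is a fin_num)
  then (`|u (c 0%R) - u (c l)| <= line_integral c l g : Prop)
  else line_integral c l g = +oo.

Definition upper_gradient u g : Prop :=
  nonneg_borel g /\
  forall c l, (0 < l)%R -> arclength_curve c l -> upper_gradient_on u g c l.

Definition p_energy g : \bar R := \int[mu]_x (`|g x| `^ p).

Definition newtonian u : Prop :=
  measurable_fun setT u /\
  p_energy u + ereal_inf [set p_energy g | g in upper_gradient u] < +oo.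

(* A curve is encoded as a pair of a map and a length. *)
Definition p_exceptional (Gamma : set ((R -> X) * R)) : Prop :=
  exists rho, [/\ nonneg_borel rho, p_energy rho < +oo
    & forall c l, Gamma (c, l) -> line_integral c l rho = +oo].

Definition p_weak_upper_gradient u g : Prop :=
  nonneg_borel g /\
  exists2 Gamma, p_exceptional Gamma &
    forall c l, (0 < l)%R -> arclength_curve c l -> ~ Gamma (c, l) ->
      upper_gradient_on u g c l.

Definition minimal_p_weak_upper_gradient u g : Prop :=
  [/\ p_weak_upper_gradient u g, p_energy g < +oo
    & forall g', p_weak_upper_gradient u g' -> p_energy g' < +oo ->
        {ae mu, forall x, g x <= g' x}].

Definition average (B : set (borel X)) (u : borel X -> \bar R) : \bar R :=
  (\int[mu]_(x in B) u x) / mu B.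

Definition poincare : Prop :=
  exists CPI lambda : R, [/\ (0 < CPI)%R, (1 <= lambda)%R &
    forall u g, newtonian u -> minimal_p_weak_upper_gradient u g ->
    forall (x : X) (r : R), (0 < r)%R ->
      let B := ball x r in let lB := ball x (lambda * r)%R in
      average B (fun y => `|u y - average B u|) <=
        CPI%:E * diam B * (average lB (fun y => g y `^ p)) `^ p^-1].

End NewtonSobolev.

Definition standing_assumptions {R : realType} (X : completeMetricType R)
    (mu : {measure set (borel X) -> \bar R}) (p Cmu : R) (Om : set X) : Prop :=
  [/\ exists x y : X, x <> y,
      1 <= p,
      ball_measure_pos_fin mu /\ doubling mu Cmu,
      poincare mu p
    & domain Om /\ Om `<` setT].

(* Main.v *)
(* Completeness and doubling make bounded sequences cluster, and quasiconvexity
   (of X in the John case, of the domain itself in the uniform case) makes the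
   domain locally connected.

   A connected set of small diameter that meets E_(k+1) lies in E_k, because
   otherwise it would meet both relative boundaries, which are a positive
   distance apart.  Hence a chain shrinking to x divides every chain whose
   members it meets: ends with singleton impression are prime, and distinct
   ends with impression {x} have eventually disjoint representatives.

   Existence at x comes from nested components of the sets B(x, r) inside the
   domain.  In a John domain a John arc issuing from each of n disjoint
   representatives near x ends at the centre of a ball of radius r/(4CL) inside
   that representative, and doubling bounds the number of disjoint balls of this
   size in B(x, r).  In a uniform domain all points near x lie in one component,
   so the chain of components at x divides every chain having x in its
   impression; thus prime ends correspond to boundary points. *)
Require Import Defs.
From mathcomp Require Import all_boot all_order all_algebra.
From mathcomp Require Import all_classical all_reals all_analysis.
From mathcomp Require Import measurable_realfun ring lra.
Import Order.TTheory GRing.Theory Num.Theory.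
Import numFieldNormedType.Exports.
Set Implicit Arguments.
Unset Strict Implicit.
Unset Printing Implicit Defensive.

Local Open Scope classical_set_scope.
Local Open Scope card_scope.
Local Open Scope ring_scope.

(** * Distance criteria for closures, interiors and separated sets *)

Section MetricLemmas.
Context {R : realType} {X : metricType R}.
Implicit Types (A B T : set X) (x y z : X).

Lemma closure_mdistP A x :
  closure A x <-> forall e, 0 < e -> exists2 y, A y & mdist x y < e.
Proof.
split=> [Ax e e0|Ax B /nbhs_ballP[e /= e0 eB]].
  have [y [Ay]] := Ax _ (nbhsx_ballx x e e0).
  by rewrite ballEmdist; exists y.
have [y Ay xy] := Ax _ e0; exists y; split=> //.
by apply: eB; rewrite ballEmdist.
Qed.

Lemma interior_mdistP A x :
  interior A x <-> exists2 e, 0 < e & forall y, mdist x y < e -> A y.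
Proof.
split=> [/nbhs_ballP[e /= e0 eA]|[e e0 eA]].
  by exists e => // y xy; apply: eA; rewrite ballEmdist.
by apply/nbhs_ballP; exists e => // y; rewrite ballEmdist; exact: eA.
Qed.

Lemma open_mdist_ball x r : open (ball x r).
Proof.
rewrite openE => y; rewrite ballEmdist /= => xy.
apply/interior_mdistP; exists (r - mdist x y); first by rewrite subr_gt0.
by move=> z yz /=; have := metric_triangle x y z; lra.
Qed.

Lemma boundary_open A x : open A -> boundary A x -> closure A x /\ ~ A x.
Proof. by move=> oA [Ax]; move: (oA) => /interior_id ->. Qed.

Lemma set_dist_gt0 A B : (0 < set_dist A B)%E ->
  exists2 c, 0 < c & forall x y, A x -> B y -> c <= mdist x y.
Proof.
have le x y : A x -> B y -> (set_dist A B <= (mdist x y)%:E)%E.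
  by move=> Ax By; apply: ereal_inf_lbound; exists x => //; exists y.
case: (set_dist A B) le => [c le c0|le _|//].
  by exists c => // x y Ax By; rewrite -lee_fin; exact: le.
(* The distance is [+oo], so no pair of points exists and any positive constant serves. *)
by exists 1 => // x y Ax By; have := le _ _ Ax By.
Qed.

(** Away from the boundary, the interior and the closure of [A] have the same trace on [T], which is
    therefore relatively clopen. *)
Lemma connected_sub T A : connected T -> T `&` A !=set0 ->
  T `&` boundary A = set0 -> T `<=` A.
Proof.
move=> cT [x [Tx Ax]] TA0.
have TE : T `&` interior A = T `&` closure A.
  apply/seteqP; split=> y [Ty Ay]; split=> //.
    exact: subset_closure (interior_subset Ay).
  apply: contrapT => nAy; suff : (T `&` boundary A) y by rewrite TA0.
  by split=> //; split.
have <- : T `&` interior A = T; last by move=> y [_] /interior_subset.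
apply: cT; last by exists (closure A) => //; exact: closed_closure.
  by exists x; rewrite TE; split=> //; exact: subset_closure.
by exists (interior A) => //; exact: open_interior.
Qed.

Lemma mbounded_sub A x r : (forall y, A y -> mdist x y <= r) -> mbounded A.
Proof.
move=> xA; apply: (@le_lt_trans _ _ (r + r)%:E); last by rewrite ltry.
apply: ge_ereal_sup => _ [y Ay [z Az <-]]; rewrite lee_fin.
have := metric_triangle y x z; rewrite (metric_sym y x).
by have := xA _ Ay; have := xA _ Az; lra.
Qed.

Lemma mboundedP A : mbounded A ->
  exists r, forall x y, A x -> A y -> mdist x y <= r.
Proof.
have le x y : A x -> A y -> ((mdist x y)%:E <= diam A)%E.
  by move=> Ax Ay; apply: ereal_sup_ubound; exists x => //; exists y.
rewrite /mbounded; case: (diam A) le => // [r|] le _.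
  by exists r => x y Ax Ay; rewrite -lee_fin; exact: le.
by exists 0 => x y Ax Ay; have := le _ _ Ax Ay.
Qed.

End MetricLemmas.

(** Sequential form of properness; it plays the role of compactness of closed balls. *)
Definition bounded_seq_cluster {R : realType} (X : metricType R) : Prop :=
  forall u : nat -> X, (exists r, forall n, mdist (u 0%N) (u n) <= r) ->
  exists z, forall e, 0 < e -> forall n, exists2 m, (n <= m)%N & mdist z (u m) < e.

(** * Division of chains, and chains shrinking to a point *)

Section EndLemmas.
Context {R : realType} {X : metricType R}.
Implicit Types (Om T : set X) (x y z : X) (E F G : nat -> set X)
  (e f : set (nat -> set X)).

Lemma divides_refl E : divides E E.
Proof. by move=> k; exists k. Qed.

Lemma divides_trans E F G : divides E F -> divides F G -> divides E G.
Proof.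
move=> EF FG k; have [l Fl] := FG k; have [m Em] := EF l.
by exists m; exact: subset_trans Fl.
Qed.

Definition end_of Om E := [set F | chain Om F /\ chain_equiv E F].

Lemma end_of_refl Om E : chain Om E -> end_of Om E E.
Proof. by move=> cE; do 2![split=> //]; exact: divides_refl. Qed.

Lemma ends_end_of Om E : chain Om E -> ends Om (end_of Om E).
Proof. by move=> cE; exists E. Qed.

Lemma end_of_equiv Om E F : divides E F -> divides F E -> end_of Om E = end_of Om F.
Proof.
move=> EF FE; apply/seteqP; split=> G [cG [G1 G2]]; do 2!split=> //.
- exact: divides_trans G1.
- exact: divides_trans EF.
- exact: divides_trans G1.
- exact: divides_trans FE.
Qed.

Lemma end_rep Om e : ends Om e -> exists E, [/\ e E, chain Om E & e = end_of Om E].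
Proof. by move=> [E cE ->]; exists E; split=> //; exact: end_of_refl. Qed.

Lemma end_mem Om e E : ends Om e -> e E -> chain Om E /\ e = end_of Om E.
Proof. by move=> [F cF ->] [cE [EF FE]]; split=> //; exact: end_of_equiv. Qed.

Lemma end_mem_equiv Om e E F : ends Om e -> e E -> e F -> divides E F.
Proof.
by move=> [G cG ->] [_ [_ EG]] [_ [GF _]]; exact: divides_trans GF.
Qed.

Lemma end_dividesE Om e f E F : ends Om e -> ends Om f -> e E -> f F ->
  end_divides e f -> divides E F.
Proof.
move=> oe of_ eE fF [E' [F' [eE' fF' EF]]].
apply: divides_trans (end_mem_equiv oe eE eE') _.
exact: divides_trans EF (end_mem_equiv of_ fF' fF).
Qed.

Lemma impression_end_of Om E : chain Om E ->
  impression (end_of Om E) = \bigcap_k closure (E k).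
Proof. by move=> cE; exact: impressionE (ends_end_of cE) (end_of_refl cE). Qed.

Lemma chain_le Om E m n : chain Om E -> (m <= n)%N -> E n `<=` E m.
Proof.
move=> [_ nE _ _]; elim: n => [|n IH]; first by rewrite leqn0 => /eqP ->.
rewrite leq_eqVlt => /predU1P[->//|mn]; exact: subset_trans (nE n) (IH mn).
Qed.

Lemma chain_sub Om E k : chain Om E -> E k `<=` Om.
Proof. by case=> /(_ k)[_ _ [] //]. Qed.

Lemma chain_connected Om E k : chain Om E -> connected (E k).
Proof. by case=> /(_ k)[]. Qed.

Lemma chain_neq0 Om E k : chain Om E -> E k !=set0.
Proof.
case=> /(_ k)[_ _ _ [y [yE _]]] _ _ _.
by have [z [Ez _]] := yE _ filterT; exists z.
Qed.

(* A connected set meeting [E k.+1] and leaving [E k] meets both boundaries,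
   which are a positive distance apart. *)
Lemma chain_gap Om E k : chain Om E -> exists2 c, 0 < c &
  forall T, connected T -> T `<=` Om ->
    (forall y z, T y -> T z -> mdist y z < c) ->
    T `&` E k.+1 !=set0 -> T `<=` E k.
Proof.
move=> cE; case: (cE) => _ nE /(_ k)/set_dist_gt0[c c0 Ec] _; exists c => //.
move=> T cT TO Tc TE; apply: contrapT => TEk.
have meet A : T `&` A !=set0 -> ~ T `<=` A -> exists2 y, T y & (Om `&` boundary A) y.
  move=> TA nTA; have [TA0|/set0P[y [Ty Ay]]] := eqVneq (T `&` boundary A) set0.
    by case: nTA; exact: connected_sub.
  by exists y => //; split=> //; exact: TO.
have [y Ty Ey] : exists2 y, T y & (Om `&` boundary (E k.+1)) y.
  by apply: meet => // TE1; apply: TEk; exact: subset_trans (nE k).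
have [z Tz Ez] : exists2 z, T z & (Om `&` boundary (E k)) z.
  by apply: meet => //; case: TE => w [Tw /nE]; exists w.
by have := Ec _ _ Ey Ez; have := Tc _ _ Ty Tz; rewrite ltNge => /negP.
Qed.

Definition shrinks_to E x := forall r, 0 < r -> exists k, E k `<=` ball x r.

Lemma shrinks_bigcap_closure E x : shrinks_to E x ->
  \bigcap_k closure (E k) `<=` [set x].
Proof.
move=> sE y yE; apply: contrapT => /= /eqP; rewrite eq_sym -mdist_gt0 => xy.
have xy2 : 0 < mdist x y / 2 by rewrite divr_gt0.
have [k Ek] := sE _ xy2; have /closure_mdistP/(_ _ xy2)[z Ekz yz] := yE k I.
have := Ek _ Ekz; rewrite ballEmdist /=.
have := metric_triangle x z y; rewrite (metric_sym z y).
set d := mdist x y in yz *; lra.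
Qed.

Lemma shrinks_impression Om E x : chain Om E -> shrinks_to E x ->
  \bigcap_k closure (E k) = [set x].
Proof.
move=> cE sE; apply/seteqP; split=> [|_ -> k _]; first exact: shrinks_bigcap_closure.
apply/closure_mdistP => r /sE[l El]; have [y Ey] := chain_neq0 (maxn k l) cE.
exists y; first exact: chain_le cE (leq_maxl k l) _ Ey.
have /El : E l y by exact: chain_le cE (leq_maxr k l) _ Ey.
by rewrite ballEmdist.
Qed.

Lemma chain_cluster Om E : bounded_seq_cluster X -> chain Om E ->
  forall u, (forall k, E k (u k)) ->
  exists z, (forall r, 0 < r -> forall n, exists2 m, (n <= m)%N & mdist z (u m) < r)
    /\ forall k, closure (E k) z.
Proof.
move=> bX cE u uE; have [|z zu] := bX u.
  case: (cE) => /(_ 0%N)[/mboundedP[r Er] _ _ _] _ _ _; exists r => n.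
  by apply: Er => //; exact: chain_le cE (leq0n n) _ (uE n).
exists z; split=> // k; apply/closure_mdistP => r /zu/(_ k)[m km zm].
by exists (u m) => //; exact: chain_le cE km _ (uE m).
Qed.

(** Points of [E k] chosen outside [ball x r] would cluster in the impression, that is at [x]. *)
Lemma impression_shrinks Om E x : bounded_seq_cluster X -> chain Om E ->
  \bigcap_k closure (E k) = [set x] -> shrinks_to E x.
Proof.
move=> bX cE iE r r0; apply: contrapT => /forallNP nE.
have /choice[u uP] k : exists y, E k y /\ ~ ball x r y.
  by have /nonsubset[y [Ey nxy]] := nE k; exists y.
have [z [zu zE]] := chain_cluster bX cE (fun k => (uP k).1).
have zx : z = x by have : (\bigcap_k closure (E k)) z by []; rewrite iE.
have [m _ xm] := zu _ r0 0%N.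
by apply: (uP m).2; rewrite ballEmdist /= -zx.
Qed.

Lemma impression_neq0 Om e : bounded_seq_cluster X -> ends Om e ->
  impression e !=set0.
Proof.
move=> bX [E cE ->]; rewrite impression_end_of//.
have /choice[u uE] k : exists y, E k y := chain_neq0 k cE.
by have [z [_ zE]] := chain_cluster bX cE uE; exists z.
Qed.

Lemma impression_boundary Om e : ends Om e -> impression e `<=` boundary Om.
Proof. by move=> [E cE ->]; rewrite impression_end_of//; case: cE. Qed.

(** A late member of [E] is connected, smaller than the gap of [F] at [k], and meets [F k.+1];
    [chain_gap] puts it inside [F k]. *)
Lemma shrinks_divides Om E F x : chain Om E -> chain Om F -> shrinks_to E x ->
  (forall k, E k `&` F k !=set0) -> divides E F.
Proof.
move=> cE cF sE EF k; have [c c0 Fc] := chain_gap k cF.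
have /sE[l El] : 0 < c / 2 by rewrite divr_gt0.
exists (maxn l k.+1); apply: Fc.
- exact: chain_connected cE.
- exact: chain_sub cE.
- move=> y z /(chain_le cE (leq_maxl _ _))/El + /(chain_le cE (leq_maxl _ _))/El.
  rewrite !ballEmdist /= => xy xz.
  have := metric_triangle y x z; rewrite (metric_sym y x); lra.
- have [y [Ey /(chain_le cF (leq_maxr _ _)) Fy]] := EF (maxn l k.+1).
  by exists y.
Qed.

(** A chain dividing [E] meets every member of [E] at the same index, so [shrinks_divides] gives the
    reverse division. *)
Lemma shrinks_prime Om E x : chain Om E -> shrinks_to E x ->
  prime_ends Om (end_of Om E).
Proof.
move=> cE sE; split; first exact: ends_end_of.
move=> f of_ fE; have [F [fF cF fEq]] := end_rep of_.
have FE := end_dividesE of_ (ends_end_of cE) fF (end_of_refl cE) fE.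
rewrite fEq; apply: end_of_equiv => //.
apply: (shrinks_divides cE cF sE) => k.
have [l Fl] := FE k; have [y Fy] := chain_neq0 (maxn l k) cF.
exists y; split; first by apply: Fl; exact: chain_le cF (leq_maxl l k) _ Fy.
exact: chain_le cF (leq_maxr l k) _ Fy.
Qed.

Lemma shrinks_disjoint Om E F x : chain Om E -> chain Om F ->
  shrinks_to E x -> shrinks_to F x -> end_of Om E <> end_of Om F ->
  exists k, E k `&` F k = set0.
Proof.
move=> cE cF sE sF nEF; apply: contrapT => /forallNP EF.
have {}EF k : E k `&` F k !=set0 by apply/set0P/eqP; exact: EF.
apply: nEF; apply: end_of_equiv; first exact: shrinks_divides cE cF sE EF.
by apply: (shrinks_divides cF cE sF) => k; rewrite setIC.
Qed.

Lemma singleton_end_rep Om e x : bounded_seq_cluster X -> ends Om e ->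
  impression e = [set x] ->
  exists E, [/\ chain Om E, shrinks_to E x & e = end_of Om E].
Proof.
move=> bX [E cE ->]; rewrite impression_end_of// => iE; exists E; split=> //.
exact: impression_shrinks bX cE iE.
Qed.

End EndLemmas.

(** * Local components and the chain they form at a boundary point *)

Section LocalChains.
Context {R : realType} {X : metricType R}.
Implicit Types (Om A T D : set X) (x y z w : X) (U : nat -> set X) (r s C : R).

(** Common consequence of quasiconvexity of [X] and of the arcs of a uniform domain, so that one set
    of lemmas serves both cases. *)
Definition quasiconnected A C := forall x y, A x -> A y ->
  exists T, [/\ connected T, T `<=` A, T x, T y &
    forall z, T z -> mdist x z <= C * mdist x y].

(** Connectedness im kleinen at every point of [Om]. *)
Definition locally_connected Om := forall y r, Om y -> 0 < r ->
  exists2 d, 0 < d & forall z, mdist y z < d ->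
    exists T, [/\ connected T, T `<=` Om `&` ball y r, T y & T z].

Lemma quasiconnected_local A Om C : 1 <= C -> quasiconnected A C ->
  Om `<=` A -> open Om ->
  forall y r, (forall z, mdist y z < r -> Om z) ->
  forall z, mdist y z < r / C ->
    exists T, [/\ connected T, T `<=` Om `&` ball y r, T y & T z].
Proof.
move=> C1 qA OA oO y r yO z; have C0 : 0 < C by exact: lt_le_trans C1.
rewrite ltr_pdivlMr// mulrC => zr.
have yz0 := mdist_ge0 y z; have yzC : mdist y z <= C * mdist y z.
  by rewrite ler_peMl.
have [|T [cT TA Ty Tz yT]] := qA y z _ (OA _ (yO _ (le_lt_trans yzC zr))).
  by apply/OA/yO; rewrite mdistxx; lra.
exists T; split=> // w /yT yw; rewrite ballEmdist.
by have yr := le_lt_trans yw zr; split=> //; exact: yO.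
Qed.

Lemma quasiconnected_locally_connected A Om C : 1 <= C ->
  quasiconnected A C -> Om `<=` A -> open Om -> locally_connected Om.
Proof.
move=> C1 qA OA oO y r Oy r0.
have /interior_mdistP[s s0 sO] : interior Om y by move: oO => /interior_id ->.
exists (Num.min s r / C).
  by rewrite divr_gt0 ?lt_min ?s0 ?r0// (lt_le_trans _ C1).
move=> z yz; have [w|T [cT TO Ty Tz]] := quasiconnected_local C1 qA OA oO _ yz.
  by rewrite lt_min => /andP[/sO].
exists T; split=> // w /TO[Ow]; rewrite !ballEmdist /= lt_min => /andP[_ yw].
by split.
Qed.

Definition local_component Om x r z := connected_component (Om `&` ball x r) z.

Lemma local_component_sub Om x r z y :
  local_component Om x r z y -> Om y /\ mdist x y < r.
Proof. by move=> /connected_component_sub[Oy]; rewrite ballEmdist. Qed.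

(** Beyond distance [r] a point is not in the closure; at a smaller distance it has a neighbourhood
    inside one component. *)
Lemma local_component_boundary Om x r z y : locally_connected Om ->
  Om y -> boundary (local_component Om x r z) y -> mdist x y = r.
Proof.
move=> lO Oy [Uy nUy]; apply/eqP; rewrite eq_le; apply/andP; split.
  rewrite leNgt; apply/negP => ry.
  have /closure_mdistP/(_ (mdist x y - r))[|w /local_component_sub[Ow xw] yw] := Uy.
    by rewrite subr_gt0.
  by have := metric_triangle x w y; rewrite (metric_sym w y); lra.
rewrite leNgt; apply/negP => yr; apply: nUy.
have [|d d0 dO] := lO y (r - mdist x y) Oy; first by rewrite subr_gt0.
have yU v w : mdist y v < d -> mdist y w < d ->
    local_component Om x r v w.
  have sub T : T `<=` Om `&` ball y (r - mdist x y) -> T `<=` Om `&` ball x r.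
    move=> TO u /TO[Ou]; rewrite !ballEmdist /= => yu; split=> //.
    by have := metric_triangle x y u; lra.
  move=> /dO[T [cT /sub TO Ty Tv]] /dO[S [cS /sub SO Sy Sw]].
  apply: (@connected_component_trans _ _ y).
    exact: connected_component_max Ty.
  exact: connected_component_max Sw.
have /closure_mdistP/(_ _ d0)[w Uw yw] := Uy.
apply/interior_mdistP; exists d => // v yv.
exact: connected_component_trans Uw (yU _ _ yw yv).
Qed.

(* Every set accumulating at [x] accumulates at [x] within a single component of
   [Om `&` ball x r]; this replaces finite connectedness at the boundary. *)
Definition accessible Om x := exists2 r0, 0 < r0 & forall r D,
  0 < r -> r < r0 -> D `<=` Om -> closure D x ->
  exists z, closure (D `&` local_component Om x r z) x.

Lemma exists_div_lt r s : 0 < r -> 0 < s -> exists n, r / n.+1%:R < s.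
Proof.
move=> r0 s0; exists (Num.truncn (r / s)).
by rewrite ltr_pdivrMr// mulrC -ltr_pdivrMr// truncnS_gt.
Qed.

(** Accessibility, applied to a component accumulating at [x], selects inside it a component for the
    next radius that still accumulates at [x]. Relative boundaries lie on spheres about [x] of
    different radii, hence a positive distance apart. *)
Lemma local_chain Om x : open Om -> Om !=set0 -> locally_connected Om ->
  boundary Om x -> accessible Om x ->
  exists U, [/\ chain Om U, shrinks_to U x & forall n, exists r z,
    [/\ 0 < r, U n = local_component Om x r z & closure (U n) x]].
Proof.
move=> oO [w0 Ow0] lO bx [r0 r00 acc]; have [Ox nOx] := boundary_open oO bx.
have xw0 : 0 < mdist x w0 by rewrite mdist_gt0; apply/eqP => xw; rewrite xw in nOx.
(* The bound [mdist x w0] keeps [w0] out of every component, which makes their inclusion in [Om]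
   proper. *)
pose r1 := Num.min (r0 / 2) (mdist x w0).
have r10 : 0 < r1 by rewrite lt_min divr_gt0.
pose r n := r1 / n.+1%:R; have rgt0 n : 0 < r n by rewrite divr_gt0.
have rS n : r n.+1 < r n by rewrite ltr_pM2l// ltf_pV2 ?posrE// ltr_nat.
have rr1 n : r n <= r1 by rewrite ler_pdivrMr// ler_pMr// ler1n.
have rr0 n : r n < r0.
  by apply: le_lt_trans (rr1 n) _; rewrite gt_min ltr_pdivrMr// ltr_pMr// ltr1n.
(* The closure condition is a premise so that [choice] yields a selector on all pairs; where it
   fails, the value [x] is arbitrary. *)
have step (p : nat * X) : exists z', closure (local_component Om x (r p.1) p.2) x ->
    closure (local_component Om x (r p.1.+1) z') x /\
    local_component Om x (r p.1.+1) z' `<=` local_component Om x (r p.1) p.2.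
  case: p => n z /=.
  have [Ux|nUx] := pselect (closure (local_component Om x (r n) z) x);
    last by exists x.
  have [|z' Vx] := acc (r n.+1) (local_component Om x (r n) z) (rgt0 _) (rr0 _) _ Ux.
    by move=> y /local_component_sub[].
  exists z' => _; split; first by apply: closureS Vx; exact: subIsetr.
  have [w [[Uw Vw] _]] := Vx _ filterT.
  move=> y Vy; apply: connected_component_trans Uw _.
  apply: (@connected_component_max _ _ (local_component Om x (r n.+1) z')) => //.
    move=> v /local_component_sub[Ov xv]; rewrite ballEmdist; split=> //=.
    exact: lt_trans xv (rS n).
  exact: component_connected.
have [g gP] := choice step.
have [z0 z0P] := acc (r 0%N) Om (rgt0 _) (rr0 _) (@subset_refl _ _) Ox.
pose z := nat_rect (fun=> X) z0 (fun n z => g (n, z)).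
pose U n := local_component Om x (r n) (z n).
have Ux n : closure (U n) x.
  elim: n => [|n IH]; first by apply: closureS z0P; exact: subIsetr.
  exact: (gP (n, z n) IH).1.
have US n : U n.+1 `<=` U n by exact: (gP (n, z n) (Ux n)).2.
have sU : shrinks_to U x.
  move=> s s0; have [n rn] := exists_div_lt r10 s0; exists n.
  by move=> y /local_component_sub[_ xy]; rewrite ballEmdist; exact: lt_trans rn.
exists U; split=> //; last by move=> n; exists (r n), (z n).
split=> //; last by move=> y /(shrinks_bigcap_closure sU) ->.
  move=> n; split.
  - by apply: (@mbounded_sub _ _ _ x (r n)) => y /local_component_sub[_ /ltW].
  - exact: component_connected.
  - split; first by move=> y /local_component_sub[].
    move=> /(_ _ Ow0)/local_component_sub[_]; apply/negP; rewrite -leNgt.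
    by apply: le_trans (rr1 n) _; rewrite ge_min lexx orbT.
  - by exists x.
move=> n; apply: (@lt_le_trans _ _ (r n - r n.+1)%:E).
  by rewrite lte_fin subr_gt0.
apply: le_ereal_inf_tmp => _ [y [Oy bUy] [w [Ow bUw] <-]]; rewrite lee_fin.
have := local_component_boundary lO Oy bUy.
have := local_component_boundary lO Ow bUw.
have := metric_triangle x y w; lra.
Qed.

Lemma quasiconnected_component Om C x r y z : 0 < r -> 1 <= C ->
  quasiconnected Om C -> Om y -> Om z ->
  mdist x y < r / (2 * C + 1) -> mdist x z < r / (2 * C + 1) ->
  local_component Om x r y z.
Proof.
move=> r0 C1 qO Oy Oz; set s := r / _ => xy xz.
have rs : (2 * C + 1) * s = r by rewrite /s mulrC divfK//; lra.
have [T [cT TO Ty Tz yT]] := qO _ _ Oy Oz.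
apply: (connected_component_max Ty) => // w Tw; split; first exact: TO.
rewrite ballEmdist /=; have := yT _ Tw; have := metric_triangle x y w.
have := metric_triangle y x z; rewrite (metric_sym y x) => yz.
have : C * mdist y z <= C * (2 * s) by rewrite ler_pM2l; lra.
by lra.
Qed.

(** All points of [Om] close to [x] share one local component; the radius bound 1 is arbitrary. *)
Lemma quasiconnected_accessible Om C x : 1 <= C -> quasiconnected Om C ->
  accessible Om x.
Proof.
move=> C1 qO; exists 1 => // r D r0 _ DO Dx.
have s0 : 0 < r / (2 * C + 1) by rewrite divr_gt0//; lra.
have /closure_mdistP/(_ _ s0)[z Dz xz] := Dx; exists z.
apply/closure_mdistP => e e0.
have [|w Dw] := (closure_mdistP _ _).1 Dx (Num.min e (r / (2 * C + 1))).
  by rewrite lt_min e0.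
rewrite lt_min => /andP[we xw]; exists w => //; split=> //.
by apply: quasiconnected_component xz xw => //; exact: DO.
Qed.

Lemma quasiconnected_chain_nbhs Om C U x n r z : 0 < r -> 1 <= C ->
  quasiconnected Om C -> U n = local_component Om x r z -> closure (U n) x ->
  exists2 s, 0 < s & forall y, Om y -> mdist x y < s -> U n y.
Proof.
move=> r0 C1 qO Un Ux; have s0 : 0 < r / (2 * C + 1) by rewrite divr_gt0//; lra.
exists (r / (2 * C + 1)) => // y Oy xy.
have /closure_mdistP/(_ _ s0)[w + xw] := Ux; rewrite Un => Uw.
apply: (connected_component_trans Uw); apply: quasiconnected_component xw xy => //.
exact: (local_component_sub Uw).1.
Qed.

End LocalChains.

(** A crude count of doublings, linear in [a / b], from [n < 2 ^ n]. *)
Lemma le_expn2 {R : realType} (a b : R) : 0 < b ->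
  a <= 2 ^+ (Num.truncn (a / b)).+1 * b.
Proof.
move=> b0; rewrite -ler_pdivrMr//; apply: le_trans (ltW (truncnS_gt _)) _.
by rewrite -natrX ler_nat ltnW// ltn_expl.
Qed.

(** * Doubling measures: packing bound and cluster points *)

Section Packing.
Context {R : realType} {X : completeMetricType R}.
Variables (mu : {measure set (borel X) -> \bar R}) (Cmu : R).
Hypotheses (mu_ball : ball_measure_pos_fin mu) (mu_doubling : doubling mu Cmu).
Implicit Types (x y z : X) (r s : R).

Lemma measurable_ball x r : measurable (ball x r : set (borel X)).
Proof. by apply: sub_sigma_algebra; exact: open_mdist_ball. Qed.

Lemma doubling_ge0 x : 0 <= Cmu.
Proof.
have [mu1 mu1oo] := andP (mu_ball x ltr01).
have := mu_doubling x ltr01.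
have [mu2 _] := andP (mu_ball x (mulr_gt0 (ltr0Sn R 1) ltr01)).
case: (mu (ball x 1)) mu1 mu1oo => // a a0 _ /(lt_le_trans mu2).
by rewrite -EFinM lte_fin pmulr_lgt0// => /ltW.
Qed.

Lemma doubling_iter x r m : 0 < r ->
  (mu (ball x (2 ^+ m * r)) <= (Cmu ^+ m)%:E * mu (ball x r))%E.
Proof.
move=> r0; elim: m => [|m IH]; first by rewrite !expr0 mul1r mul1e.
rewrite exprS -mulrA; apply: le_trans (mu_doubling _ _) _.
  by rewrite mulr_gt0// exprn_gt0.
by rewrite exprS EFinM -muleA lee_wpmul2l// lee_fin (doubling_ge0 x).
Qed.

(** Each [ball (z i) (2 ^+ m * s)] contains [ball x r], so each small ball carries at least the
    fraction [1 / Cmu ^+ m] of its measure, and the small balls are disjoint inside it. *)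
Lemma packing n (z : 'I_n -> X) x r s m : 0 < r -> 0 < s ->
  (forall i, ball (z i) s `<=` ball x r) ->
  (forall i j, i != j -> ball (z i) s `&` ball (z j) s = set0) ->
  2 * r <= 2 ^+ m * s -> n%:R <= Cmu ^+ m.
Proof.
move=> r0 s0 zx zz rs; have [mr mroo] := andP (mu_ball x r0).
have bz i : (mu (ball x r) <= (Cmu ^+ m)%:E * mu (ball (z i) s))%E.
  apply: le_trans (doubling_iter (z i) m s0).
  apply: le_measure; rewrite ?inE; try exact: measurable_ball.
  move=> y; rewrite !ballEmdist /= => xy; have := zx i (z i).
  rewrite !ballEmdist /= mdistxx => /(_ s0); rewrite metric_sym.
  by have := metric_triangle (z i) x y; lra.
have C0 := exprn_ge0 m (doubling_ge0 x).
case E : (mu (ball x r)) mr mroo bz => [a| |]; rewrite ?ltxx// lte_fin => a0 _ bz.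
rewrite -(ler_pM2r a0) mulr_natl -lee_fin.
apply: (@le_trans _ _ (\sum_(i < n) (Cmu ^+ m)%:E * mu (ball (z i) s))%E).
  rewrite -[n in (a *+ n)%:E]card_ord -sumr_const -sumEFin.
  by apply: lee_sum => i _; exact: bz.
rewrite -ge0_sume_distrr; last by move=> i _; exact: measure_ge0.
rewrite EFinM lee_wpmul2l// -E.
rewrite -(@measure_bigsetU_ord _ _ _ mu n predT (fun i => ball (z i) s)).
- apply: le_measure; rewrite ?inE.
  + by apply: bigsetU_measurable => i _; exact: measurable_ball.
  + exact: measurable_ball.
  + by elim/big_ind : _ => // A B AB BB y [/AB|/BB].
- by move=> i; exact: measurable_ball.
- by apply/trivIsetP => i j _ _; exact: zz.
Qed.

(** An ultrafilter refining the tails of [u] is Cauchy; by completeness it has a limit, which is a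
    cluster point. *)
Lemma doubling_seq_cluster : bounded_seq_cluster X.
Proof.
move=> u [r ur].
have [G [GU uG]] := ultraFilterLemma (fmap_proper_filter u eventually_filter).
have r0 : 0 <= r by apply: le_trans (ur 0%N); exact: mdist_ge0.
have GB : G (ball (u 0%N) (r + 1)).
  by apply: uG; exists 0%N => // n _ /=; rewrite ballEmdist /=; have := ur n; lra.
(* If [G] contained no ball of radius [e], one could pick arbitrarily many
   [e]-separated points in a bounded set. *)
have cG : cauchy G.
  apply: cauchy_exP => e e0; apply: contrapT => /forallNP nG.
  (* The last clause drives the induction: the points far from all chosen ones form a set of [G],
     which therefore meets the bounded ball. *)
  have sep n : exists s : nat -> X,
    [/\ forall i, (i < n)%N -> ball (u 0%N) (r + 1) (s i),
      forall i j, (i < j < n)%N -> e <= mdist (s i) (s j)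
    & G [set y | forall i, (i < n)%N -> e <= mdist (s i) y]].
    elim: n => [|n [s [sB ss Gs]]].
      by exists u; split=> // [i j|]; [rewrite andbC|apply: filterS filterT].
    have [y [Gy By]] := filter_ex (filterI Gs GB).
    exists (fun i => if (i < n)%N then s i else y); split.
    - by move=> i; case: ifPn => [/sB|].
    - move=> i j /andP[ij]; rewrite ltnS => jn.
      rewrite (leq_trans ij jn); case: ifPn => [jn'|_]; first by apply: ss; rewrite ij.
      exact/Gy/(leq_trans ij jn).
    - have [/nG//|GN] := in_ultra_setVsetC (ball y e) GU.
      apply: filterS (filterI Gs GN) => w [sw yw] i _; case: ifPn => [/sw//|_].
      by move: yw; rewrite ballEmdist /= leNgt => /negP.
  (* [m] doublings enlarge the radius [e / 2] enough for [packing] in the ball of radius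
     [r + 1 + e], and [n] exceeds the resulting bound. *)
  pose m := (Num.truncn (2 * (r + 1 + e) / (e / 2))).+1.
  pose n := (Num.truncn (Cmu ^+ m)).+1.
  have [s [sB ss _]] := sep n.
  have : n%:R <= Cmu ^+ m; last by apply/negP; rewrite -ltNge truncnS_gt.
  apply: (@packing n s (u 0%N) (r + 1 + e) (e / 2) m); rewrite ?divr_gt0//; try lra.
  - move=> i y; have := sB _ (ltn_ord i); rewrite !ballEmdist /= => usi siy.
    by have := metric_triangle (u 0%N) (s i) y; lra.
  - have disj i j : (i < j < n)%N -> ball (s i) (e / 2) `&` ball (s j) (e / 2) = set0.
      move=> ij; rewrite -subset0 => y; rewrite !ballEmdist => -[/= iy jy].
      have := ss _ _ ij; have := metric_triangle (s i) y (s j).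
      by rewrite (metric_sym y); lra.
    move=> i j; rewrite -val_eqE neq_ltn => /orP[] ij.
      by apply: disj; rewrite ij /=.
    by rewrite setIC; apply: disj; rewrite ij /=.
  - by apply: le_expn2; rewrite divr_gt0.
have Glim : G --> lim G by exact: cauchy_cvg.
exists (lim G) => e e0 n.
have Gl : G (ball (lim G) e) by apply: Glim; exact: nbhsx_ballx.
have Gn : G [set u m | m in [set m | (n <= m)%N]].
  by apply: uG; exists n => // m nm; exists m.
have [y [ly [m nm umy]]] := filter_ex (filterI Gl Gn).
by exists m => //; move: ly; rewrite ballEmdist -umy.
Qed.

End Packing.

(** * Arcs, and accessibility of boundary points of John domains *)

Section Curves.
Context {R : realType} {X : metricType R}.
Implicit Types (Om T : set X) (x y z w v : X) (c : R -> X) (a b l r s t C L : R).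

Lemma mdist_le_curve_length a b c t : a <= t -> t <= b ->
  ((mdist (c a) (c t))%:E <= curve_length a b c)%E.
Proof.
move=> at_ tb; have le p d : itv_partition a b p -> d <= curve_variation a b c p ->
    (d%:E <= curve_length a b c)%E.
  move=> pp dp; apply: (@le_trans _ _ (curve_variation a b c p)%:E) => //.
  by apply: ereal_sup_ubound; exists p.
(* Partitions are strictly increasing, so the cases where [t] is an endpoint are separate. *)
have [ta|ta] := eqVneq t a.
  have [ab|ab] := eqVneq a b.
    apply: (le [::]); first by split=> //=; exact/eqP.
    by rewrite /curve_variation big_nil ta mdistxx.
  apply: (le [:: b]); first by split=> //=; rewrite andbT lt_neqAle ab -ta.
  by rewrite /curve_variation !big_nat1 ta mdistxx /= mdist_ge0.
have {}at_ : a < t by rewrite lt_neqAle eq_sym ta.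
have [tb'|tb'] := eqVneq t b.
  apply: (le [:: b]); first by split=> //=; rewrite andbT -tb'.
  by rewrite /curve_variation !big_nat1 /= tb'.
apply: (le [:: t; b]); first by split=> //=; rewrite at_ andbT lt_neqAle tb'.
by rewrite /curve_variation !big_nat_recr//= big_nil add0r lerDl mdist_ge0.
Qed.

Lemma arclength_lipschitz c l s t : arclength_curve c l ->
  0 <= s -> s <= t -> t <= l -> mdist (c s) (c t) <= t - s.
Proof.
by move=> [_ cl] s0 st tl; rewrite -lee_fin -cl//; exact: mdist_le_curve_length.
Qed.

Lemma arclength_connected c l : arclength_curve c l ->
  connected (c @` [set t | 0 <= t <= l]).
Proof.
move=> cl; have -> : [set t | 0 <= t <= l] = `[0, l]%classic.
  by apply/seteqP; split=> t; rewrite /= in_itv.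
apply: connected_continuous_connected; first exact: segment_connected.
apply/subspace_continuousP => t; rewrite /= in_itv /= => /andP[t0 tl].
apply/cvg_ballP => e e0; rewrite near_withinE; near=> s.
rewrite /= in_itv /= => /andP[s0 sl].
have : `|t - s| < e by near: s; exact: nbhsx_ballx.
rewrite ballEmdist /=; have [st|ts] := leP s t.
  rewrite ger0_norm ?subr_ge0// metric_sym.
  by have := arclength_lipschitz cl s0 st tl; lra.
rewrite ler0_norm ?subr_le0 ?(ltW ts)// opprB.
by have := arclength_lipschitz cl t0 (ltW ts) sl; lra.
Unshelve. all: by end_near. Qed.

Lemma quasiconvex_quasiconnected L : quasiconvex X L -> quasiconnected [set: X] L.
Proof.
move=> qX x y _ _; have [a [b [c [ab cc ca cb cL]]]] := qX x y.
exists (c @` `[a, b]); split=> //.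
- by apply: connected_continuous_connected => //; exact: segment_connected.
- by exists a => //=; rewrite in_itv /= lexx.
- by exists b => //=; rewrite in_itv /= lexx ab.
- move=> _ [t + <-]; rewrite /= in_itv /= -lee_fin => /andP[at_ tb].
  by apply: le_trans cL; rewrite -ca; exact: mdist_le_curve_length.
Qed.

Lemma quasiconvex_ge1 L x y : quasiconvex X L -> x != y -> 1 <= L.
Proof.
move=> qX xy; have [a [b [c [ab _ ca cb cL]]]] := qX x y.
rewrite -(ler_pM2r (_ : 0 < mdist x y)) ?mdist_gt0// mul1r -lee_fin.
by apply: le_trans cL; rewrite -{1}ca -cb; exact: mdist_le_curve_length.
Qed.

Lemma uniform_quasiconnected Om : uniform_domain Om ->
  exists2 C, 1 <= C & quasiconnected Om C.
Proof.
move=> [C C1 uO]; exists C => // x y Ox Oy.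
have [c [l [cl cO [cx cy] lC _]]] := uO x y Ox Oy; have l0 : 0 <= l by case: cl.
exists (c @` [set t | 0 <= t <= l]); split.
- exact: arclength_connected.
- by move=> _ [t tl <-]; exact: cO.
- by exists 0 => //=; rewrite lexx.
- by exists l => //=; rewrite lexx l0.
- move=> _ [t /= /andP[t0 tl] <-]; rewrite -cx.
  by have := arclength_lipschitz cl (lexx 0) t0 tl; rewrite cx; lra.
Qed.

(* [T] is the initial piece of length [s] of a John curve, and [w] its end. *)
Lemma john_initial_arc Om C x0 y s : john Om C x0 -> Om y ->
  0 <= s -> s <= mdist y x0 -> exists T w,
  [/\ connected T, T `<=` Om, T y & T w] /\
  [/\ forall z, T z -> mdist y z <= s & forall v, ~ Om v -> s <= C * mdist w v].
Proof.
move=> [C1 _ jO] Oy s0 sy; have [c [l [cl cO cy cx0 cC]]] := jO y Oy.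
have l0 : 0 <= l by case: cl.
have sl : s <= l.
  by have := arclength_lipschitz cl (lexx 0) l0 (lexx l); rewrite cy cx0; lra.
have cs : arclength_curve c s.
  by split=> // u t u0 ut ts; case: cl => _ ->//; exact: le_trans sl.
exists (c @` [set t | 0 <= t <= s]), (c s); split; split.
- exact: arclength_connected.
- by move=> _ [t /= /andP[t0 ts] <-]; apply: cO; rewrite t0 (le_trans ts).
- by exists 0 => //=; rewrite lexx.
- by exists s => //=; rewrite lexx s0.
- move=> _ [t /= /andP[t0 ts] <-]; rewrite -cy.
  by have := arclength_lipschitz cl (lexx 0) t0 (le_trans ts sl); lra.
- move=> v nOv; have := cC s; rewrite s0 sl => /(_ isT) sC.
  rewrite -lee_fin; apply: le_trans sC _; rewrite EFinM.
  rewrite lee_wpmul2l ?lee_fin//; first by lra.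
  by apply: ereal_inf_lbound; exists (c s) => //; exists v.
Qed.

(** John arcs of length [r / 2] carry points of [D] near [x] to points at distance at least
    [r / 2 / C] from the complement. Those cluster at some [z] in [Om], and the arcs ending near [z]
    lie in its local component together with their starting points. *)
Lemma john_accessible Om C L x0 x : bounded_seq_cluster X ->
  1 <= L -> quasiconnected [set: X] L -> open Om -> john Om C x0 ->
  boundary Om x -> accessible Om x.
Proof.
move=> bX L1 qX oO jO bx; have [C1 Ox0 _] := jO.
have [_ nOx] := boundary_open oO bx.
(* Radii below [mdist x x0] leave room for an arc of length [r / 2] before the John centre. *)
exists (mdist x x0); first by rewrite mdist_gt0; apply/eqP => xx0; rewrite xx0 in nOx.
move=> r D r0 rx0 DO Dx.
have rn (n : nat) : 0 < r / 4 / n.+1%:R by rewrite !divr_gt0.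
(* A triple: a point of [D], the arc issuing from it, and the end of that arc. *)
have /choice[p pP] n : exists p : X * set X * X,
    [/\ D p.1.1, mdist x p.1.1 < r / 4 / n.+1%:R,
      connected p.1.2, p.1.2 `<=` Om `&` ball x r & p.1.2 p.1.1] /\
    [/\ p.1.2 p.2, mdist x p.2 <= r / 4 * 3
      & forall v, ~ Om v -> r / 2 <= C * mdist p.2 v].
  have [y Dy xy] := (closure_mdistP _ _).1 Dx _ (rn n).
  have xy4 : mdist x y < r / 4.
    by apply: lt_le_trans xy _; rewrite ler_pdivrMr// ler_pMr ?ler1n// divr_gt0.
  have [||T [w [[cT TO Ty Tw] [yT wO]]]] := john_initial_arc jO (DO _ Dy) (s := r / 2).
  - lra.
  - by have := metric_triangle x y x0; lra.
  exists (y, T, w); do 2!split=> //=.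
  - move=> z Tz; split; first exact: TO.
    rewrite ballEmdist /=; have := yT _ Tz; have := metric_triangle x y z; lra.
  - by have := yT _ Tw; have := metric_triangle x y w; lra.
have [|z zp] := bX (fun n => (p n).2).
  exists (r / 4 * 3 + r / 4 * 3) => n.
  have [_ [_ x0p _]] := pP 0%N; have [_ [_ xnp _]] := pP n.
  by have := metric_triangle (p 0%N).2 x (p n).2; rewrite (metric_sym _ x) /=; lra.
have C0 : 0 < C by lra.
have Oz : Om z.
  apply: contrapT => nOz; have [|m _] := zp (r / 2 / C) _ 0%N.
    by rewrite !divr_gt0.
  have [_ [_ _ /(_ _ nOz)]] := pP m.
  by rewrite ltr_pdivlMr// metric_sym mulrC; lra.
have xz : mdist x z < r.
  have [|m _ zm] := zp (r / 4) _ 0%N; first by rewrite divr_gt0.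
  have [_ [_ xm _]] := pP m.
  by have := metric_triangle x (p m).2 z; rewrite (metric_sym (p m).2); lra.
have [|d d0 dO] := quasiconnected_locally_connected L1 qX (@subsetT _ Om) oO
  (r := r - mdist x z) Oz; first by rewrite subr_gt0.
exists z; apply/closure_mdistP => e e0.
have r40 : 0 < r / 4 by rewrite divr_gt0.
have [n ne] := exists_div_lt r40 e0; have [m nm zm] := zp _ d0 n.
have [[Dy xy cT TO Ty] [Tw _ _]] := pP m.
exists (p m).1.1; last first.
  apply: lt_trans xy (le_lt_trans _ ne).
  by rewrite ler_pM2l// lef_pV2 ?posrE// ler_nat ltnS.
split=> //; have [S [cS SO Sz Sw]] := dO _ zm.
apply: (@connected_component_trans _ _ (p m).2); last first.
  exact: (connected_component_max Tw).
apply: (connected_component_max Sz) => // v /SO[Ov]; rewrite !ballEmdist /= => zv.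
by split=> //; have := metric_triangle x z v; lra.
Qed.

End Curves.

(** Reduces the cardinal bound to injective finite families; an infinite [P] would contain a copy of
    [I_N.+1]. *)
Lemma card_le_I {T : Type} (P : set T) N :
  (forall n (f : 'I_n -> T), (forall i, P (f i)) -> injective f -> (n <= N)%N) ->
  P #<= `I_N.
Proof.
move=> PN; have key n : `I_n #<= P -> (n <= N)%N.
  move=> /card_leP[f]; have In (i : 'I_n) : `I_n (val i) by exact: ltn_ord.
  pose d (i : 'I_n) : `I_n := SigSub (mem_set (In i)).
  apply: (PN n (fun i => set_val (f (d i)))) => [i|i j].
    exact: set_valP.
  move=> /val_inj/(@inj _ _ _ f); rewrite !in_setT => /(_ isT isT).
  by move=> /(congr1 val) /= /val_inj.
have [[n /card_eqPle[Pn nP]]|/infiniteP nP] := pselect (finite_set P).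
  by apply: card_le_trans Pn _; rewrite card_le_II; exact: key.
have := key N.+1 (card_le_trans (card_leT _) nP).
by rewrite ltnn.
Qed.

(** * Counting ends at a boundary point of a John domain *)

Section JohnCount.
Context {R : realType} {X : completeMetricType R}.
Variables (mu : {measure set (borel X) -> \bar R}) (Cmu : R).
Hypotheses (mu_ball : ball_measure_pos_fin mu) (mu_doubling : doubling mu Cmu).
Implicit Types (Om : set X) (x y z : X) (C L : R).

Lemma john_disjoint_chains Om C L x0 x n (E : 'I_n -> nat -> set X) :
  1 <= L -> quasiconnected [set: X] L -> open Om -> john Om C x0 ->
  boundary Om x -> (forall i, chain Om (E i) /\ shrinks_to (E i) x) ->
  (forall i j, i != j -> end_of Om (E i) <> end_of Om (E j)) ->
  n%:R <= Cmu ^+ (Num.truncn (8 * C * L)).+1.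
Proof.
move=> L1 qX oO jO bx EP nE; have [C1 Ox0 _] := jO.
have [_ nOx] := boundary_open oO bx.
have xx0 : 0 < mdist x x0 by rewrite mdist_gt0; apply/eqP => xe; rewrite xe in nOx.
have /choice[K KP] (ij : 'I_n * 'I_n) : exists k, ij.1 != ij.2 ->
    E ij.1 k `&` E ij.2 k = set0.
  have [eij|nij] := eqVneq ij.1 ij.2; first by exists 0%N.
  have [[ci si] [cj sj]] := (EP ij.1, EP ij.2).
  by have [k kP] := shrinks_disjoint ci cj si sj (nE _ _ nij); exists k.
(* Members decrease, so at the largest index all pairs are disjoint at once. *)
pose k := (\max_ij K ij)%N.
have Edisj i j : i != j -> E i k `&` E j k = set0.
  move=> ij; rewrite -subset0 -(KP (i, j) ij) => y [Ei Ej].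
  have Kk : (K (i, j) <= k)%N by exact: leq_bigmax.
  by split; [exact: chain_le (EP i).1 Kk _ Ei|exact: chain_le (EP j).1 Kk _ Ej].
have /choice[c cP] i : exists c, 0 < c /\ forall T, connected T -> T `<=` Om ->
    (forall y z, T y -> T z -> mdist y z < c) -> T `&` E i k.+1 !=set0 -> T `<=` E i k.
  by have [c c0 Tc] := chain_gap k (EP i).1; exists c.
(* One radius for all chains: points of [ball x r] are then closer to each other than every gap
   constant [c i]. *)
have small_c : \forall r \near (0 : R)^'+, forall i, r < c i / 2.
  by apply: filter_forall => i; apply: nbhs_right_lt; rewrite divr_gt0//; case: (cP i).
have [r [[rx r0] rc]] :=
  filter_ex (filterI (filterI (nbhs_right_lt xx0) (nbhs_right_gt (0 : R))) small_c).
have r40 : 0 < r / 4 by rewrite divr_gt0.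
(* An arc of length [r / 4] ends at least [rho] from the complement, and quasiconvexity joins points
   of [ball w s] to [w] within [ball w rho]. *)
pose rho := r / 4 / C; pose s := rho / L.
have C0 : 0 < C by lra. have L0 : 0 < L by lra.
have rho0 : 0 < rho by rewrite divr_gt0.
have s0 : 0 < s by rewrite divr_gt0.
have rho4 : rho <= r / 4 by rewrite ler_pdivrMr// ler_peMr// ltW.
have srho : s <= rho by rewrite ler_pdivrMr// ler_peMr// ltW.
have /choice[w wP] i : exists w, mdist x w <= r / 2 /\ ball w s `<=` E i k.
  have /closure_mdistP/(_ _ r40)[y Ey xy] : closure (E i k.+1) x.
    have : [set x] x by []; rewrite -(shrinks_impression (EP i).1 (EP i).2); exact.
  have Oy := chain_sub (EP i).1 Ey.
  have [||T [w [[cT TO Ty Tw] [yT wO]]]] := john_initial_arc jO Oy (s := r / 4).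
  - exact: ltW.
  - by have := metric_triangle x y x0; lra.
  have xT z : T z -> mdist x z <= r / 2.
    by move=> /yT; have := metric_triangle x y z; lra.
  exists w; split; first exact: xT.
  move=> v; rewrite ballEmdist /= => wv.
  have wrho z : mdist w z < rho -> Om z.
    move=> wz; apply: contrapT => /wO; apply/negP; rewrite -ltNge mulrC.
    by rewrite -ltr_pdivlMr.
  have [S [cS SO Sw Sv]] := quasiconnected_local L1 qX (@subsetT _ Om) oO wrho wv.
  (* The arc and the connecting set together lead from [E i k.+1] to [v] without leaving
     [ball x r]. *)
  apply: ((cP i).2 (T `|` S)); last by right.
  - by apply: connectedU => //; exists w.
  - by move=> z [/TO|/SO[]].
  - have xTS z : (T `|` S) z -> mdist x z < r.
      move=> [/xT|/SO[_]]; first by lra.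
      rewrite ballEmdist /= => wz; have := xT _ Tw.
      by have := metric_triangle x w z; lra.
    move=> z z' /xTS + /xTS; have := rc i.
    by have := metric_triangle z x z'; rewrite (metric_sym z x); lra.
  - by exists y; split=> //; left.
apply: (packing mu_ball mu_doubling (z := w) (x := x) r0 s0).
- move=> i y; rewrite !ballEmdist /=; have [xw _] := wP i.
  by have := metric_triangle x (w i) y; lra.
- move=> i j ij; rewrite -subset0 -(Edisj i j ij) => y [yi yj].
  by split; [exact: (wP i).2|exact: (wP j).2].
have -> : 2 * r = 8 * C * L * s.
  by rewrite /s /rho; field; rewrite !gt_eqF.
by rewrite ler_pM2r//; have := @le_expn2 R (8 * C * L) 1 ltr01; rewrite divr1 mulr1.
Qed.

End JohnCount.

Lemma get_set1 (T : pointedType) (x : T) : get [set x] = x.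
Proof. by apply: (@getPex _ [set x]); exists x. Qed.

(** * Closed sets in the space of points and ends *)

Section EndTopology.
Context {R : realType} {X : metricType R}.
Hypothesis bX : bounded_seq_cluster X.
Implicit Types (Om A : set X) (x y : X) (E : nat -> set X).

(** Points of [E k] within [1 / k.+1] of [A] cluster at a point of the impression, which lies in
    [A]. *)
Lemma chain_closed_meet Om E A : chain Om E -> closed A ->
  (forall k, closure (E k) `&` A !=set0) -> \bigcap_k closure (E k) `&` A !=set0.
Proof.
move=> cE clA EA.
have /choice[v vP] k : exists v, E k v /\ exists2 a, A a & mdist v a < 1 / k.+1%:R.
  have [a [Ea Aa]] := EA k.
  have [|v Ev av] := (closure_mdistP _ _).1 Ea (1 / k.+1%:R); first by rewrite divr_gt0.
  by exists v; split=> //; exists a => //; rewrite metric_sym.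
have [z [zv zE]] := chain_cluster bX cE (fun k => (vP k).1).
exists z; split=> //; apply: clA; apply/closure_mdistP => e e0.
have e20 : 0 < e / 2 by rewrite divr_gt0.
have [n ne] := exists_div_lt ltr01 e20; have [m nm zm] := zv _ e20 n.
have [_ [a Aa ma]] := vP m; exists a => //.
apply: le_lt_trans (metric_triangle z (v m) a) _; rewrite [e]splitr ltrD//.
apply: lt_trans ma (le_lt_trans _ ne).
by rewrite ler_pM2l// lef_pV2 ?posrE// ler_nat ltnS.
Qed.

(** On the prime end closure of a uniform domain this is the preimage of [A] under [limit_point], so
    [touches_closed] yields continuity of that map. *)
Definition touches Om A : set (end_space Om) :=
  [set z | match z with
           | Pt x => A (set_val x)
           | End e => impression (set_val e) `&` A !=set0
           end].

Lemma touches_closed Om A : closed A -> end_space_closed (@touches Om A).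
Proof.
move=> clA z [x|e] zA /= => [[u zu ux]|ze].
  apply: clA; apply/closure_mdistP => r r0.
  have /filter_ex[n] : \forall n \near \oo, ball (set_val x) r (set_val (u n)).
    by apply: ux; exact: nbhsx_ballx.
  by rewrite ballEmdist => xu; exists (set_val (u n)) => //; have := zA n; rewrite zu.
have [E [eE cE _]] := end_rep (set_valP e).
rewrite (impressionE (set_valP e) eE); apply: (chain_closed_meet cE clA) => k.
case: ze => [[u zu /(_ _ eE k)/filter_ex[n Eun]]|[f zf /(_ _ eE k)/filter_ex[n fE]]].
  exists (set_val (u n)); split; first exact: subset_closure.
  by have := zA n; rewrite zu.
have := zA n; rewrite zf /= => -[a [ia Aa]]; exists a; split=> //.
have [F [fF cF _]] := end_rep (set_valP (f n)); have [l Fl] := fE _ fF.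
by apply: closureS Fl _ _; move: ia; rewrite (impressionE (set_valP (f n)) fF); exact.
Qed.

End EndTopology.

(** * Uniform domains: prime ends correspond to boundary points *)

Section UniformDomain.
Context {R : realType} {X : completeMetricType R}.
Hypothesis bX : bounded_seq_cluster X.
Variables (Om : set X) (C : R).
Hypotheses (oO : open Om) (O0 : Om !=set0) (C1 : 1 <= C) (qO : quasiconnected Om C).
Implicit Types (x y : X) (U E F : nat -> set X) (e : set (nat -> set X)).

(** The last clause makes [U] meet, at every index, any chain with [x] in its impression, and hence
    divide it. *)
Definition base_chain x U := [/\ chain Om U, shrinks_to U x &
  forall n, exists2 s, 0 < s & forall y, Om y -> mdist x y < s -> U n y].

Lemma exists_base_chain x : boundary Om x -> exists U, base_chain x U.
Proof.
move=> bx; have lO := quasiconnected_locally_connected C1 qO (@subset_refl _ Om) oO.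
have [U [cU sU Un]] := local_chain oO O0 lO bx (quasiconnected_accessible x C1 qO).
exists U; split=> // n; have [r [z [r0 UE Ux]]] := Un n.
exact: quasiconnected_chain_nbhs r0 C1 qO UE Ux.
Qed.

Lemma base_chain_divides x U E : base_chain x U -> chain Om E ->
  (\bigcap_k closure (E k)) x -> divides U E.
Proof.
move=> [cU sU Us] cE xE; apply: (shrinks_divides cU cE sU) => k.
have [s s0 sU'] := Us k; have /closure_mdistP/(_ _ s0)[y Ey xy] := xE k I.
by exists y; split=> //; apply: sU' => //; exact: chain_sub cE _ Ey.
Qed.

Lemma prime_end_base x U e : base_chain x U -> prime_ends Om e ->
  impression e x -> e = end_of Om U.
Proof.
move=> bU [eO pe] ex; have [cU _ _] := bU; have [E [eE cE _]] := end_rep eO.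
rewrite (impressionE eO eE) in ex.
apply/esym/pe; first exact: ends_end_of.
exists U, E; split=> //; first exact: end_of_refl.
exact: base_chain_divides ex.
Qed.

Lemma base_chain_impression x U : base_chain x U ->
  impression (end_of Om U) = [set x].
Proof.
by move=> [cU sU _]; rewrite impression_end_of//; exact: shrinks_impression cU sU.
Qed.

Lemma base_chain_prime x U : base_chain x U -> prime_ends Om (end_of Om U).
Proof. by move=> [cU sU _]; exact: shrinks_prime cU sU. Qed.

Lemma unique_prime_end x : boundary Om x ->
  exists! e, prime_ends Om e /\ impression e = [set x].
Proof.
move=> /exists_base_chain[U bU]; exists (end_of Om U); split.
  by split; [exact: base_chain_prime bU|exact: base_chain_impression].
move=> e [pe ie]; apply/esym; apply: (prime_end_base bU pe).
by rewrite ie.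
Qed.

Lemma prime_end_impression e : prime_ends Om e ->
  exists2 x, boundary Om x & impression e = [set x].
Proof.
move=> pe; have [x ex] := impression_neq0 bX pe.1.
have bx : boundary Om x by exact: impression_boundary pe.1 _ ex.
exists x => //; have [U bU] := exists_base_chain bx.
by rewrite (prime_end_base bU pe ex) (base_chain_impression bU).
Qed.

(** The underlying map of the homeomorphism. [get] extracts the point of the singleton impression of
    a prime end; its choice at other ends is immaterial. *)
Definition limit_point (z : end_space Om) : X :=
  match z with
  | Pt x => set_val x
  | End e => get (impression (set_val e))
  end.

Lemma limit_pointE (e : ends Om) : prime_ends Om (set_val e) ->
  boundary Om (limit_point (End e)) /\
  impression (set_val e) = [set limit_point (End e)].
Proof.
by move=> /prime_end_impression[x bx ie]; rewrite /= ie get_set1.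
Qed.

Lemma touches_limit_point A z : prime_end_closure Om z ->
  touches A z = A (limit_point z).
Proof.
case: z => // e /limit_pointE[_ ie]; apply/propext.
rewrite -[touches A _]/(impression (set_val e) `&` A !=set0) ie.
by split=> [[y [-> Ay]]|Ae]; last by exists (limit_point (End e)); split.
Qed.

Lemma limit_point_closure z : prime_end_closure Om z -> closure Om (limit_point z).
Proof.
case: z => [x _|e /limit_pointE[[]//]]; exact/subset_closure/set_valP.
Qed.

Lemma limit_point_inj z w : prime_end_closure Om z -> prime_end_closure Om w ->
  limit_point z = limit_point w -> z = w.
Proof.
have bO x (e : ends Om) : Om x -> prime_ends Om (set_val e) -> x <> limit_point (End e).
  by move=> Ox /limit_pointE[/(boundary_open oO)[_ nOx] _] xe; rewrite -xe in nOx.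
case: z w => [x|e] [y|f] //= pz pw.
- by move/val_inj => ->.
- by move/(bO _ _ (set_valP x) pw).
- by move/esym/(bO _ _ (set_valP y) pz).
- move=> ef; congr End; apply: val_inj.
  have [bx ie] := limit_pointE pz; have [_ if_] := limit_pointE pw.
  have [U bU] := exists_base_chain bx.
  transitivity (end_of Om U); first by apply: (prime_end_base bU pz); rewrite ie.
  apply/esym/(prime_end_base bU pw); rewrite if_; exact: ef.
Qed.

Lemma limit_point_surj x : closure Om x ->
  exists2 z, prime_end_closure Om z & limit_point z = x.
Proof.
move=> Ox; have [Ox'|nOx] := pselect (Om x).
  by exists (Pt (SigSub (mem_set Ox'))).
have [|U bU] := @exists_base_chain x.
  by split=> //; move: oO => /interior_id ->.
exists (End (SigSub (mem_set (base_chain_prime bU).1))) => /=.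
  exact: base_chain_prime bU.
by rewrite (base_chain_impression bU) get_set1.
Qed.

Lemma base_chain_absorbs x U e : base_chain x U -> prime_ends Om e ->
  impression e x -> forall E, e E -> forall k, exists2 s, 0 < s &
  forall y, Om y -> mdist x y < s -> E k y.
Proof.
move=> bU pe ex E eE k; have [cU _ Us] := bU.
have ee := prime_end_base bU pe ex.
have UE : divides U E by move: eE; rewrite ee => -[_ []].
have [l UEk] := UE k; have [s s0 Uls] := Us l.
by exists s => // y Oy xy; exact/UEk/Uls.
Qed.

Lemma prime_end_nbhs (e : ends Om) E k : prime_ends Om (set_val e) ->
  set_val e E -> exists2 s, 0 < s &
  forall y, Om y -> mdist (limit_point (End e)) y < s -> E k y.
Proof.
move=> pe eE; have [bx ie] := limit_pointE pe; have [U bU] := exists_base_chain bx.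
by apply: (base_chain_absorbs bU pe) => //; rewrite ie.
Qed.

(** Gives continuity of the inverse map. The image is split into images of points and of ends
    because only sequences of one kind converge in the end space. *)
Lemma limit_point_closed K z : end_space_closed K -> prime_end_closure Om z ->
  closure (limit_point @` (K `&` prime_end_closure Om)) (limit_point z) -> K z.
Proof.
move=> clK pz; set a := limit_point z.
pose A1 := [set y | exists2 x : Om, K (Pt x) & set_val x = y].
pose A2 := [set y | exists e : ends Om,
  [/\ K (End e), prime_ends Om (set_val e) & limit_point (End e) = y]].
have -> : limit_point @` (K `&` prime_end_closure Om) = A1 `|` A2.
  apply/seteqP; split=> y.
    by move=> [[x|e] [Kz pe] <-]; [left; exists x|right; exists e].
  by move=> [[x Kx <-]|[e [Ke pe <-]]]; [exists (Pt x)|exists (End e)].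
have inv0 n : 0 < 1 / n.+1%:R :> R by rewrite divr_gt0.
have eventually_lt s : 0 < s -> \forall n \near \oo, 1 / n.+1%:R < s :> R.
  move=> s0; have [n0 n0s] := exists_div_lt ltr01 s0; exists n0 => // n n0n.
  by apply: le_lt_trans n0s; rewrite ler_pM2l// lef_pV2 ?posrE// ler_nat ltnS.
rewrite closureU => -[/closure_mdistP Aa|/closure_mdistP Aa].
  have /choice[u uP] n : exists x : Om, K (Pt x) /\ mdist a (set_val x) < 1 / n.+1%:R.
    by have [_ [x Kx <-] ax] := Aa _ (inv0 n); exists x.
  apply: (clK (@Pt _ _ Om \o u)) => [n|]; first by case: (uP n).
  case: z pz @a Aa u uP => [x|e] /= pz Aa u uP.
    exists u => //; apply/cvg_ballP => s s0; near=> n.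
    rewrite ballEmdist /=; apply: lt_trans (uP n).2 _.
    by near: n; exact: eventually_lt.
  left; exists u => // E eE k; have [s s0 sE] := prime_end_nbhs k pz eE.
  apply: filterS (eventually_lt _ s0) => n ns; apply: sE; first exact: set_valP.
  exact: lt_trans (uP n).2 ns.
have /choice[f fP] n : exists e : ends Om, [/\ K (End e), prime_ends Om (set_val e)
    & mdist a (limit_point (End e)) < 1 / n.+1%:R].
  by have [_ [e [Ke pe <-]] ae] := Aa _ (inv0 n); exists e.
case: z pz @a Aa f fP => [x|e] /= pz Aa f fP.
  (* Ends cannot approach a point of the open set [Om], since their limit points lie on its
     boundary. *)
  have /interior_mdistP[s s0 sO] : interior Om (set_val x).
    by move: (oO) => /interior_id ->; exact: set_valP.
  have [n ns] := exists_div_lt ltr01 s0; have [_ pe xe] := fP n.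
  have [be _] := limit_pointE pe; have [_ nO] := boundary_open oO be.
  by case: nO; apply: sO; exact: lt_trans ns.
apply: (clK (@End _ _ Om \o f)) => [n|]; first by case: (fP n).
right; exists f => // E eE k; have [s s0 sE] := prime_end_nbhs k pz eE.
(* One half bounds the distance between limit points, the other the size of a late member of [F]. *)
have s20 : 0 < s / 2 by rewrite divr_gt0.
apply: filterS (eventually_lt _ s20) => n ns F fF; have [_ pn en] := fP n.
have [_ ie] := limit_pointE pn; have [cF fE] := end_mem (set_valP (f n)) fF.
have /impression_shrinks : \bigcap_k closure (F k) = [set limit_point (End (f n))].
  by rewrite -ie (impressionE (set_valP (f n)) fF).
move=> /(_ Om bX cF _ s20)[l Fl]; exists l => y Fy.
apply: sE; first exact: chain_sub cF _ Fy.
have := Fl _ Fy; rewrite ballEmdist /=.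
have := metric_triangle (limit_point (End e)) (limit_point (End (f n))) y.
have := lt_trans en ns; rewrite /=; lra.
Unshelve. all: by end_near. Qed.

Lemma prime_end_homeomorphism :
  exists Upsilon : prime_end_closure Om -> closure Om,
    homeomorphism Upsilon /\
    forall (z : prime_end_closure Om) (x : Om),
      set_val z = Pt x -> set_val (Upsilon z) = set_val x.
Proof.
pose Y (z : prime_end_closure Om) : closure Om :=
  SigSub (mem_set (limit_point_closure (set_valP z))).
have /choice[G GP] (x : closure Om) : exists z : prime_end_closure Om,
    limit_point (set_val z) = set_val x.
  have [z pz zx] := limit_point_surj (set_valP x).
  by exists (SigSub (mem_set pz)).
have YK : cancel Y G.
  move=> z; apply: val_inj; apply: limit_point_inj; try exact: set_valP.
  exact: GP.
have GK : cancel G Y by move=> x; apply: val_inj; exact: GP.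
have YE z : set_val (Y z) = limit_point (set_val z) by [].
exists Y; split; last by move=> z x zx; rewrite YE zx.
exists G; split=> //; apply/continuousP => _ [V oV <-].
  exists (~` touches (~` V)).
    apply: closed_openC; rewrite closed_end_spaceE.
    exact/touches_closed/open_closedC.
  rewrite -[V in RHS]setCK; apply/seteqP; split=> z /=.
    by rewrite touches_limit_point ?YE//; exact: set_valP.
  by rewrite touches_limit_point ?YE//; exact: set_valP.
(* [A] is the preimage under [G] of the complement of [V]; by [limit_point_closed] its closure adds
   no point of [closure Om]. *)
pose A := limit_point @` (~` V `&` prime_end_closure Om).
exists (~` closure A); first exact/closed_openC/closed_closure.
have clV : end_space_closed (~` V) by rewrite -closed_end_spaceE; exact: open_closedC.
apply/seteqP; split=> x /= => [nAx|Vx Ax].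
  apply: contrapT => nVx; apply: nAx; apply: subset_closure.
  by exists (set_val (G x)); [split=> //; exact: set_valP|exact: GP].
have /limit_point_closed : closure A (limit_point (set_val (G x))) by rewrite GP.
by move=> /(_ clV (set_valP (G x))); exact.
Qed.

End UniformDomain.

Theorem corollary11p8 (R : realType) :
  (exists N : R -> R -> R -> nat,
    (forall Cmu COm L : R, (0 < N Cmu COm L)%N) /\
    forall (X : completeMetricType R)
      (mu : {measure set (borel X) -> \bar R}) (p Cmu : R) (Om : set X),
      standing_assumptions mu p Cmu Om ->
      forall (COm L : R) (x0 : X), quasiconvex X L -> john Om COm x0 ->
      forall x : X, boundary Om x ->
        let P := [set e | prime_ends Om e /\ impression e = [set x]] in
        P !=set0 /\ P #<= `I_(N Cmu COm L))
  /\
  (forall (X : completeMetricType R)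
      (mu : {measure set (borel X) -> \bar R}) (p Cmu : R) (Om : set X),
      standing_assumptions mu p Cmu Om ->
      uniform_domain Om ->
      (forall x : X, boundary Om x ->
         exists! e, prime_ends Om e /\ impression e = [set x]) /\
      exists Upsilon : prime_end_closure Om -> closure Om,
        homeomorphism Upsilon /\
        forall (z : prime_end_closure Om) (x : Om),
          set_val z = Pt x -> set_val (Upsilon z) = set_val x).
Proof.
split.
  (* The packing bound rounded up to an integer; the outer successor also makes it positive. *)
  exists (fun Cmu COm L => (Num.truncn (Cmu ^+ (Num.truncn (8 * COm * L)).+1)).+1).
  split=> // X mu p Cmu Om [_ _ [mu_ball mu_doubling] _ [[oO _ O0 _] _]].
  move=> COm L x0 qX jO x bx.
  have bX := doubling_seq_cluster mu_ball mu_doubling.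
  have [_ nOx] := boundary_open oO bx.
  have L1 : 1 <= L.
    apply: (quasiconvex_ge1 qX (x := x) (y := x0)).
    by apply/eqP => xx0; case: jO; rewrite -xx0.
  have {}qX := quasiconvex_quasiconnected qX.
  split.
    have lO := quasiconnected_locally_connected L1 qX (@subsetT _ Om) oO.
    have [U [cU sU _]] := local_chain oO O0 lO bx (john_accessible bX L1 qX oO jO bx).
    exists (end_of Om U); split; first exact: shrinks_prime cU sU.
    by rewrite impression_end_of//; exact: shrinks_impression cU sU.
  apply: card_le_I => n f fP f_inj.
  have /choice[E EP] i : exists E, [/\ chain Om E, shrinks_to E x & f i = end_of Om E].
    by have [[fo _] fi] := fP i; exact: singleton_end_rep.
  rewrite -(ler_nat R); apply: le_trans (ltW (truncnS_gt _)).
  apply: (john_disjoint_chains mu_ball mu_doubling (E := E) L1 qX oO jO bx).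
    by move=> i; have [] := EP i.
  by move=> i j ij; have [[_ _ <-] [_ _ <-]] := (EP i, EP j) => /f_inj/eqP; apply/negP.
move=> X mu p Cmu Om [_ _ [mu_ball mu_doubling] _ [[oO _ O0 _] _]].
move=> /uniform_quasiconnected[C C1 qO].
have bX := doubling_seq_cluster mu_ball mu_doubling.
split; last exact: (prime_end_homeomorphism bX oO O0 C1 qO).
by move=> x bx; exact: (unique_prime_end oO O0 C1 qO bx).
Qed.
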